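(* Let $a,b,c\geq1$ with $d=a+b+c$ prime. Then Alice's announcement of $\sum_d A$ (equivalently, Bob's announcement of $\sum_d B$) is secure for all deals of size $(a,b,c)$ if and only if \[ab-2a-b-c+1\geq 0 \quad\text{and}\quad ab-2b-a-c+1\geq 0.\]
   Context: Cards are the integers $0,\dots,d-1$, $D=\{0,\dots,d-1\}$. A deal of size $(a,b,c)$ is a triple $(A,B,C)$ of pairwise disjoint subsets of $D$ of sizes $a,b,c$ held by Alice, Bob and Cath respectively; initially each player knows only her own hand. For $X\subseteq D$, $\sum_d X$ is the sum of the elements of $X$ in $\mathbb Z/(d)$. Announcing $\sum_d A$ is secure for all deals of size $(a,b,c)$ if for every deal $(A,B,C)$ of that size and every card $z\notin C$ there exist deals $(A',B',C)$ and $(A'',B'',C)$ of that size with $\sum_d A'=\sum_d A''=\sum_d A$, $z\notin A'$ and $z\notin B''$; i.e. after the announcement Cath does not know of any card that Alice holds it nor of any card that Bob holds it. *)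

(* Defs.v *)
From mathcomp Require Import all_boot all_order all_algebra.

Set Implicit Arguments.
Unset Strict Implicit.
Unset Printing Implicit Defensive.

Import GRing.Theory.
Local Open Scope ring_scope.

(* Cards are the elements of 'I_d. *)
Definition is_deal (a b c d : nat) (A B C : {set 'I_d}) : Prop :=
  [/\ [disjoint A & B], [disjoint A & C] & [disjoint B & C]] /\
  [/\ #|A| = a, #|B| = b & #|C| = c].

(* 'Z_d is Z/(d) only for d >= 2; this always holds for a prime d. *)
Definition sum_mod (d : nat) (X : {set 'I_d}) : 'Z_d :=
  \sum_(x in X) (x : nat)%:R.

(* [ann A B] is the public announcement made when Alice holds A and Bob
   holds B. *)
Definition secure (a b c d : nat) (T : Type)
    (ann : {set 'I_d} -> {set 'I_d} -> T) : Prop :=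
  forall A B C : {set 'I_d}, is_deal a b c A B C ->
  forall z : 'I_d, z \notin C ->
    (exists A' B' : {set 'I_d},
       [/\ is_deal a b c A' B' C, ann A' B' = ann A B & z \notin A']) /\
    (exists A'' B'' : {set 'I_d},
       [/\ is_deal a b c A'' B'' C, ann A'' B'' = ann A B & z \notin B'']).

Definition alice_announces_sum (d : nat) (A B : {set 'I_d}) : 'Z_d := sum_mod A.

Definition bob_announces_sum (d : nat) (A B : {set 'I_d}) : 'Z_d := sum_mod B.

(* Main.v *)
Require Import Defs.
From mathcomp Require Import all_boot all_order all_fingroup
  all_algebra all_field.
From mathcomp Require Import zify ring.

(* Fix Cath's hand C and a card z outside it. Alice can be imagined not to hold
   z iff some a-subset of the a + b - 1 remaining cards has the announced sum.
   By the Dias da Silva-Hamidoune theorem on restricted sums, the a-subsets of an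
   n-subset of Z/p have at least min(p, a(n - a) + 1) distinct sums, here
   min(d, a(b - 1) + 1), and intervals attain the bound; so this is always
   possible iff d <= a(b - 1) + 1, which is the first inequality. Since the sums
   of A and B determine each other once C is known, the second one is obtained by
   exchanging Alice and Bob.
   The case of the restricted sum theorem where all residues are reached is
   proved with the polynomial method of Alon, Nathanson and Ruzsa, the
   coefficient extraction being performed by a product of linear functionals, one
   for each variable, so that only univariate moments occur. *)

Set Implicit Arguments.
Unset Strict Implicit.
Unset Printing Implicit Defensive.

Import GRing.Theory.
Local Open Scope ring_scope.

(** * Coefficient extraction on tuples *)

Lemma sum_tuple_cons (V : nmodType) (I : finType) (n : nat)
    (G : n.+1.-tuple I -> V) :
  \sum_t G t = \sum_x \sum_(t : n.-tuple I) G [tuple of x :: t].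
Proof.
rewrite pair_big /=.
rewrite (reindex (fun q : I * n.-tuple I => [tuple of q.1 :: q.2])) //=.
exists (fun t => (thead t, [tuple of behead t])) => [[x t] _|t _] /=.
  by congr (_, _); apply: val_inj.
by rewrite [RHS]tuple_eta; apply: val_inj.
Qed.

(* Each [u j] extracts the coefficient of [x^(c j)] from polynomials of degree at
   most [c j]; their product, applied to [prod_j x_j^(e j) * (sum_j x_j + r)^N],
   gives [N! / prod_j (c j - e j)!] when the degree is exactly [sum_j c j]. The
   falling factorials in the statement encode the vanishing when some
   [e j > c j]. *)
Lemma moment_expansion (R : comNzRingType) (I : finType) (phi : I -> R)
    (h : nat) (u : nat -> I -> R) (c e : nat -> nat) (N : nat) (r : R) :
    (forall j i, (j < h)%N -> (i <= c j)%N ->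
      \sum_x u j x * phi x ^+ i = (i == c j)%:R) ->
    (\sum_(j < h) e j + N <= \sum_(j < h) c j)%N ->
  (\sum_(t : h.-tuple I)
     (\prod_(j < h) (u j (tnth t j) * phi (tnth t j) ^+ e j)) *
     (\sum_(j < h) phi (tnth t j) + r) ^+ N) * \prod_(j < h) (c j)`!%:R
  = ((\sum_(j < h) e j + N == \sum_(j < h) c j) * N`! *
     \prod_(j < h) (c j) ^_ (e j))%:R.
Proof.
elim: h u c e N => [|h IH] u c e N mom.
  rewrite !big_ord0 add0n leqn0 => /eqP ->.
  rewrite (big_pred1 [tuple]) => [|t]; last exact/esym/eqP/tuple0.
  by rewrite !big_ord0 expr0 !mulr1.
rewrite sum_tuple_cons !big_ord_recl /=.
pose e' j := e j.+1; pose c' j := c j.+1; pose u' j := u j.+1.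
rewrite -[X in (_ + X + _)%N]/(\sum_(i < h) e' i)%N.
rewrite -[X in (_ <= _ + X)%N]/(\sum_(i < h) c' i)%N.
rewrite -[X in (_ == _ + X)%N]/(\sum_(i < h) c' i)%N.
rewrite -[X in (_ * X)%:R]/(_ * \prod_(j < h) (c' j) ^_ (e' j))%N.
rewrite -[X in _ * X = _]/(_ * \prod_(j < h) (c' j)`!%:R).
set Se := (\sum_(i < h) e' i)%N; set Sc := (\sum_(i < h) c' i)%N => le_ec.
set Pc := \prod_(j < h) _; set Pf := (\prod_(j < h) _)%N.
pose S i := \sum_(t : h.-tuple I)
     (\prod_(j < h) (u' j (tnth t j) * phi (tnth t j) ^+ e' j)) *
     (\sum_(j < h) phi (tnth t j) + r) ^+ i.
have mom' j i : (j < h)%N -> (i <= c' j)%N ->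
    \sum_x u' j x * phi x ^+ i = (i == c' j)%:R by move=> jh; apply: mom.
have SP i : (Se + i <= Sc)%N -> S i * Pc = ((Se + i == Sc) * i`! * Pf)%:R.
  exact: IH.
(* Split off the first variable and expand the power binomially; [S i] carries the other
   variables. *)
have -> : \sum_x \sum_(t : h.-tuple I)
     (\prod_(j < h.+1) (u j (tnth [tuple of x :: t] j) *
         phi (tnth [tuple of x :: t] j) ^+ e j)) *
     (\sum_(j < h.+1) phi (tnth [tuple of x :: t] j) + r) ^+ N
   = \sum_(i < N.+1) 'C(N, i)%:R *
       (\sum_x u 0%N x * phi x ^+ (e 0%N + (N - i))) * S i.
  under [RHS]eq_bigr => i _ do rewrite mulr_sumr mulr_suml.
  rewrite [RHS]exchange_big /=; apply: eq_bigr => x _.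
  under [RHS]eq_bigr => i _ do rewrite mulr_sumr.
  rewrite [RHS]exchange_big /=; apply: eq_bigr => t _.
  rewrite [\prod_(j < h.+1) _]big_ord_recl.
  rewrite [\sum_(j < h.+1) _]big_ord_recl !tnth0.
  have -> : \sum_(j < h) phi (tnth [tuple of x :: t] (lift ord0 j)) =
      \sum_(j < h) phi (tnth t j) by apply: eq_bigr => j _; rewrite tnthS.
  have -> : \prod_(j < h)
      (u (lift ord0 j) (tnth [tuple of x :: t] (lift ord0 j)) *
        phi (tnth [tuple of x :: t] (lift ord0 j)) ^+ e (lift ord0 j)) =
      \prod_(j < h) (u' j (tnth t j) * phi (tnth t j) ^+ e' j).
    by apply: eq_bigr => j _; rewrite tnthS.
  rewrite -addrA exprDn mulr_sumr; apply: eq_bigr => i _.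
  by rewrite -mulr_natl exprD; ring.
rewrite mulr_suml.
(* Only [e 0 + (N - i) = c 0] survives: a smaller exponent is killed by the moments of [u 0], a
   larger one leaves too low a degree for [S i]. *)
have term (i : 'I_N.+1) : 'C(N, i)%:R *
    (\sum_x u 0%N x * phi x ^+ (e 0%N + (N - i))) * S i * ((c 0%N)`!%:R * Pc)
  = if (e 0 + (N - i) == c 0)%N then
     ((e 0 + Se + N == c 0 + Sc) * N`! * (c 0 ^_ e 0 * Pf))%:R else 0.
  have iN : (i <= N)%N by rewrite -ltnS.
  case: ltngtP => [lt_i|gt_i|eq_i].
  - rewrite mom // ?(ltnW lt_i) // ltn_eqF // mulr0 !mul0r //.
  - rewrite -mulrA (mulrCA (S i)) SP; last by lia.
    by rewrite ltn_eqF; [rewrite !mul0n !mulr0|lia].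
  - rewrite eq_i mom // eqxx mulr1.
    rewrite -mulrA (mulrCA (S i)) SP; last by lia.
    rewrite -!natrM; congr (_%:R).
    have -> : (e 0 + Se + N == c 0 + Sc)%N = (Se + i == Sc)%N by lia.
    rewrite -(bin_fact iN) -(@ffact_fact (c 0%N) (e 0%N)); last by lia.
    have -> : (c 0 - e 0 = N - i)%N by lia.
    set b := nat_of_bool _; ring.
under eq_bigr => i _ do rewrite term.
rewrite -big_mkcond /=.
have [lt_ce|le_ce] := ltnP (c 0%N) (e 0%N).
  rewrite (ffact_small lt_ce) mul0n muln0 big1 //.
(* If [e 0 + N < c 0], no index fits; should the total degrees agree, some later [e j] exceeds [c j]
   and its falling factorial vanishes. *)
have [lt_c|le_c] := ltnP (e 0 + N)%N (c 0%N).
  rewrite big1 => [|i /eqP]; last by lia.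
  case: eqP => [eq_ec|_]; last by rewrite !mul0n.
  suff -> : Pf = 0%N by rewrite !muln0.
  apply/eqP/negPn/negP; rewrite -lt0n => /gt0_prodn pos.
  suff : (Se <= Sc)%N by lia.
  by apply: leq_sum => j _; rewrite -ffact_gt0; apply: pos.
have i0P : (N - (c 0 - e 0) < N.+1)%N by lia.
rewrite (big_pred1 (Ordinal i0P)) // => i.
by have := ltn_ord i; rewrite /= -val_eqE /=; lia.
Qed.

(** * Restricted sums modulo a prime *)

(** Hermite's identity; it splits [N] into [h] nondecreasing parts. *)
Lemma sum_divn_shift (h N : nat) :
  (0 < h)%N -> (\sum_(j < h) (N + j) %/ h = N)%N.
Proof.
case: h => // h _; elim: N => [|N IH].
  by rewrite big1 // => j _; rewrite add0n divn_small.
rewrite big_ord_recr /= addSnnS divnDr ?dvdnn // divnn /= addnA addn1.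
congr _.+1; rewrite -[RHS]IH big_ord_recl /= addn0 addnC.
by congr addn; apply: eq_bigr => j _; rewrite /= addSnnS.
Qed.

Lemma det_Vandermonde_neq0 (F : fieldType) (n : nat) (v : 'I_n -> F) :
  injective v -> \det (Vandermonde n (\row_j v j)) != 0.
Proof.
move=> v_inj; rewrite det_Vandermonde.
apply/prodf_neq0 => i _; apply/prodf_neq0 => j lt_ij.
rewrite !mxE subr_eq0; apply: contraTneq lt_ij => /v_inj ->.
by rewrite ltnn.
Qed.

Lemma natr_ffact (R : comNzRingType) (n m : nat) :
  (n ^_ m)%:R = (\prod_(l < m) ('X - l%:R%:P)).[n%:R] :> R.
Proof.
rewrite horner_prod; under eq_bigr => l _ do rewrite !hornerE.
elim: m => [|m IH]; first by rewrite big_ord0 ffactn0.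
rewrite big_ord_recr /= -IH ffactnSr natrM.
have [le_mn|lt_nm] := leqP m n; first by rewrite natrB.
by rewrite ffact_small // !mul0r.
Qed.

(* The matrix factors as the unitriangular matrix of coefficients of the
   falling factorial polynomials times a Vandermonde matrix. *)
Lemma det_ffact_neq0 (F : fieldType) (n : nat) (c : 'I_n -> nat) :
    injective (fun j => (c j)%:R : F) ->
  \det (\matrix_(i < n, j < n) ((c j) ^_ i)%:R : 'M[F]_n) != 0.
Proof.
move=> c_inj.
pose P (i : nat) : {poly F} := \prod_(l < i) ('X - l%:R%:P).
have sizeP i : size (P i) = i.+1.
  by rewrite size_prod_XsubC [index_enum _]unlock -enumT size_enum_ord.
pose L : 'M[F]_n := \matrix_(i, j) (P i)`_j.
have -> : \matrix_(i < n, j < n) ((c j) ^_ i)%:R =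
    L *m Vandermonde n (\row_j (c j)%:R).
  apply/matrixP => i j; rewrite !mxE natr_ffact (@horner_coef_wide _ n).
    by apply: eq_bigr => l _; rewrite !mxE.
  by rewrite sizeP.
rewrite det_mulmx mulf_neq0 ?det_Vandermonde_neq0 //.
rewrite det_trig; last first.
  apply/is_trig_mxP => i j lt_ij; rewrite mxE nth_default //.
  by rewrite sizeP.
apply/prodf_neq0 => i _; rewrite mxE.
have := monic_prod_XsubC (index_enum 'I_i) xpredT (fun l => l%:R : F).
by rewrite monicE lead_coefE -/(P i) sizeP => /eqP ->; rewrite oner_eq0.
Qed.

(** The weights solve an invertible Vandermonde system; they read off the coefficient of degree
    [#|X|.-1]. *)
Lemma dual_top_power (F : fieldType) (I : finType) (phi : I -> F)
    (X : {set I}) :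
    {in X &, injective phi} -> (0 < #|X|)%N ->
  exists w : I -> F, forall i, (i < #|X|)%N ->
    \sum_(x in X) w x * phi x ^+ i = (i == #|X|.-1)%:R.
Proof.
move=> phi_inj X_gt0; have [x0 Xx0] := card_gt0P X_gt0.
pose v (j : 'I_#|X|) := phi (enum_val j).
have v_inj : injective v.
  by move=> i j /phi_inj /enum_val_inj; apply; apply: enum_valP.
pose V := Vandermonde #|X| (\row_j v j).
have V_unit : V \in unitmx by rewrite unitmxE unitfE det_Vandermonde_neq0.
have top_lt : (#|X|.-1 < #|X|)%N by rewrite prednK.
pose y : 'cV[F]_#|X| := invmx V *m delta_mx (Ordinal top_lt) 0.
exists (fun x => y (enum_rank_in Xx0 x) 0) => i lt_i.
rewrite big_enum_val /=.
transitivity ((V *m y) (Ordinal lt_i) 0).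
  by rewrite mxE; apply: eq_bigr => j _; rewrite !mxE enum_valK_in mulrC.
by rewrite mulKVmx // mxE eqxx andbT.
Qed.

(* The test function [det V * ((S - r)^(p-1) - 1)], with [S] the sum of the
   variables and [V] their Vandermonde matrix, vanishes on all tuples of
   elements of [X]; the functional built from the weights [u] extracts its
   coefficient at [prod_j x_j^(c j)], which is a nonzero multiple of the
   determinant of the falling factorials of the [c j]. *)
Lemma restricted_sums_full (p h : nat) (I : finType) (phi : I -> 'F_p)
    (X : {set I}) :
    prime p -> {in X &, injective phi} -> (0 < h <= #|X|)%N ->
    (#|X| <= p)%N -> (p.-1 <= h * (#|X| - h))%N ->
  forall r, exists A : {set I},
    [/\ A \subset X, #|A| = h & \sum_(x in A) phi x = r].
Proof.
move=> p_pr phi_inj /andP[h_gt0 le_hX] le_Xp le_ph r.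
have [/existsP[A /and3P[AX /eqP Ah /eqP Ar]]|noA] := boolP [exists A : {set I},
    [&& A \subset X, #|A| == h & \sum_(x in A) phi x == r]]; first by exists A.
have X_gt0 : (0 < #|X|)%N := leq_trans h_gt0 le_hX.
have [x0 _] := card_gt0P X_gt0; have [w wP] := dual_top_power phi_inj X_gt0.
have p_gt1 := prime_gt1 p_pr.
(* Target exponents: strictly increasing, below [#|X|], and adding up to the degree of the test
   function. *)
pose c j := (j + (p.-1 + j) %/ h)%N.
have sumc : (\sum_(j < h) c j = \sum_(j < h) j + p.-1)%N.
  by rewrite big_split /= sum_divn_shift.
have c_lt j : (j < h)%N -> (c j < #|X|)%N.
  move=> lt_jh; have : ((p.-1 + j) %/ h < (#|X| - h).+1)%N.
    by rewrite ltn_divLR // mulSn mulnC; lia.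
  by rewrite /c; lia.
have c_mono : {homo c : i j / (i < j)%N}.
  move=> i j lt_ij; rewrite /c -addSn leq_add // leq_div2r //.
  by rewrite leq_add2l ltnW.
have natF_eq0 n : (n%:R == 0 :> 'F_p) = (p %| n)%N.
  by rewrite -(dvdn_pcharf (pchar_Fp p_pr)).
have fact_neq0 n : (n < p)%N -> n`!%:R != 0 :> 'F_p.
  elim: n => [|n IH] lt_np; first by rewrite oner_eq0.
  rewrite factS natrM mulf_neq0 ?IH ?natF_eq0 ?gtnNdvd //; exact: ltnW.
(* The extra power of [phi x] shifts the degree read off from [#|X|.-1] down to [c j]. *)
pose u j x := if x \in X then w x * phi x ^+ (#|X|.-1 - c j) else 0.
have mom j i : (j < h)%N -> (i <= c j)%N ->
    \sum_x u j x * phi x ^+ i = (i == c j)%:R.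
  move=> /c_lt lt_c le_ic.
  transitivity (\sum_(x in X) w x * phi x ^+ (#|X|.-1 - c j + i)).
    rewrite [RHS]big_mkcond; apply: eq_bigr => x _; rewrite /u.
    by case: ifP => _; rewrite ?mul0r // exprD mulrA.
  rewrite wP; last by lia.
  by congr (_%:R); congr nat_of_bool; lia.
pose V (t : h.-tuple I) := Vandermonde h (\row_j phi (tnth t j)).
pose E N := \sum_(t : h.-tuple I) (\prod_(j < h) u j (tnth t j)) *
  \det (V t) * (\sum_(j < h) phi (tnth t j) - r) ^+ N.
(* Expanding the Vandermonde determinant over permutations gives one moment expansion per term; the
   signed sum is again a determinant. *)
have EP N : (N <= p.-1)%N -> E N * \prod_(j < h) (c j)`!%:R =
    (N == p.-1)%:R * N`!%:R *
    \det (\matrix_(i < h, j < h) ((c j) ^_ i)%:R : 'M['F_p]_h).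
  move=> le_N.
  pose e (s : 'S_h) j := oapp (fun o : 'I_h => val (s o)) 0%N (insub j).
  have eE s (j : 'I_h) : e s j = s j by rewrite /e valK.
  have sume s : (\sum_(j < h) e s j = \sum_(j < h) j)%N.
    rewrite [RHS](reindex_inj (@perm_inj _ s)).
    by apply: eq_bigr => j _; rewrite eE.
  have -> : E N = \sum_(s : 'S_h) (-1) ^+ s * \sum_(t : h.-tuple I)
      (\prod_(j < h) (u j (tnth t j) * phi (tnth t j) ^+ e s j)) *
      (\sum_(j < h) phi (tnth t j) - r) ^+ N.
    under [RHS]eq_bigr => s _ do rewrite mulr_sumr.
    rewrite [RHS]exchange_big; apply: eq_bigr => t _.
    rewrite -det_tr /determinant mulr_sumr mulr_suml; apply: eq_bigr => s _.
    rewrite big_split /=.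
    have -> : \prod_(j < h) phi (tnth t j) ^+ e s j =
        \prod_(i < h) (V t)^T i (s i).
      by apply: eq_bigr => j _; rewrite !mxE eE.
    by rewrite mulrCA -mulrA.
  rewrite -det_tr /determinant mulr_suml mulr_sumr; apply: eq_bigr => s _.
  rewrite -[LHS]mulrA (@moment_expansion _ _ phi h u c (e s) N (- r) mom);
    last by rewrite sume sumc leq_add2l.
  rewrite sume sumc eqn_add2l !natrM natr_prod [LHS]mulrCA; congr (_ * (_ * _)).
  by apply: eq_bigr => j _; rewrite !mxE eE.
have prodc_neq0 : \prod_(j < h) (c j)`!%:R != 0 :> 'F_p.
  apply/prodf_neq0 => j _; apply: fact_neq0.
  exact: leq_trans (c_lt _ (ltn_ord j)) le_Xp.
have E0 : E 0%N = 0.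
  apply: (mulIf prodc_neq0); rewrite EP // mul0r.
  by rewrite ltn_eqF ?mul0r //; lia.
(* Tuples leaving [X] or with a repeated entry contribute 0; for the others [noA] makes the base
   nonzero and Fermat's little theorem applies. *)
have Ep : E p.-1 = E 0%N.
  apply: eq_bigr => t _; rewrite expr0 mulr1.
  have [tX|] := boolP [forall j, tnth t j \in X]; last first.
    rewrite negb_forall => /existsP[j jX].
    by rewrite (bigD1 j) //= /u (negPf jX) !mul0r.
  have [t_uniq|] := boolP (uniq t); last first.
    move=> /(uniqPn x0)[i [j [lt_ij]]].
    rewrite size_tuple => lt_jh eq_ij.
    rewrite -det_tr (@determinant_alternate _ _ _
      (Ordinal (ltn_trans lt_ij lt_jh)) (Ordinal lt_jh)) ?mulr0 ?mul0r //.
      by rewrite -val_eqE /= ltn_eqF.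
    move=> l; rewrite !mxE; congr (phi _ ^+ _).
    by rewrite !(tnth_nth x0).
  have sum_neq : \sum_(j < h) phi (tnth t j) - r != 0.
    rewrite subr_eq0; apply: contra noA => /eqP sum_t.
    apply/existsP; exists [set x in t]; apply/and3P; split.
    - apply/subsetP => x; rewrite inE => /tnthP[j ->].
      exact: (forallP tX).
    - by rewrite cardsE (card_uniqP t_uniq) size_tuple.
    - rewrite -sum_t -(big_tuple _ _ t xpredT phi) (big_uniq _ t_uniq).
      by apply/eqP; apply: eq_bigl => x; rewrite inE.
  suff -> : (\sum_(j < h) phi (tnth t j) - r) ^+ p.-1 = 1 by rewrite mulr1.
  apply: (mulfI sum_neq); rewrite -exprS prednK ?prime_gt0 // mulr1.
  set y := (_ - r); have := expf_card y.
  by rewrite card_Fp.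
(* So [(p.-1)!] times the determinant is 0, yet both factors are nonzero, the [c j] being distinct
   and below [p]. *)
have /eqP := EP p.-1 (leqnn _).
rewrite Ep E0 mul0r eqxx mul1r eq_sym mulf_eq0 => /orP[|].
  by rewrite (negPf (fact_neq0 _ _)) //; lia.
have c_ltp (i : 'I_h) : (c i < p)%N := leq_trans (c_lt _ (ltn_ord i)) le_Xp.
rewrite (negPf (det_ffact_neq0 _)) // => i j /(congr1 (@nat_of_ord _)).
rewrite !val_Fp_nat // !modn_small // => eq_c; apply: val_inj.
by have [/c_mono|/c_mono|] := ltngtP i j; rewrite ?eq_c ?ltnn.
Qed.

(** * Extremal sums of distinct integers *)

Lemma sum_ord_double (n : nat) :
  ((\sum_(j < n) j).*2 = n * n.-1)%N.
Proof.
elim: n => [|n IH]; first by rewrite big_ord0.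
by rewrite big_ord_recr doubleD IH /=; case: n {IH} => //= n; nia.
Qed.

(** Induction: among [n.+1] distinct values one is at least [n], by pigeonhole; remove it. *)
Lemma sum_inj_lower (I : finType) (f : I -> nat) (A : {set I}) :
  {in A &, injective f} -> (\sum_(j < #|A|) j <= \sum_(x in A) f x)%N.
Proof.
move En: #|A| => n; elim: n A En => [|n IH] A En f_inj.
  by rewrite big_ord0.
have [/existsP[x /andP[Ax le_nx]]|small] :=
    boolP [exists x, (x \in A) && (n <= f x)%N].
  rewrite big_ord_recr /= (big_setD1 x) //= addnC leq_add // IH //.
    by have := cardsD1 x A; rewrite Ax En => -[].
  by apply: sub_in2 f_inj => y; rewrite inE => /andP[].
have f_lt x : x \in A -> (f x < n)%N.
  move=> Ax; rewrite ltnNge; apply: contra small => le_nx.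
  by apply/existsP; exists x; rewrite Ax.
have : (size [seq f x | x <- enum A] <= size (iota 0 n))%N.
  apply: uniq_leq_size.
    rewrite map_inj_in_uniq ?enum_uniq // => x y.
    by rewrite !mem_enum; apply: f_inj.
  by move=> _ /mapP[x Ax ->]; rewrite mem_iota /= f_lt // -mem_enum.
by rewrite size_map size_iota -cardE En ltnn.
Qed.

(** * Deals and their sums *)

Lemma is_deal_swap (a b c d : nat) (A B C : {set 'I_d}) :
  is_deal a b c A B C -> is_deal b a c B A C.
Proof.
by move=> [[AB AC BC] [Aa Bb Cc]]; split; split=> //; rewrite disjoint_sym.
Qed.

Lemma is_deal_setC (a b c d : nat) (A C : {set 'I_d}) :
    d = (a + b + c)%N -> [disjoint A & C] -> #|A| = a -> #|C| = c ->
  is_deal a b c A (~: (A :|: C)) C.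
Proof.
move=> hd AC Aa Cc; split; split=> //.
- by rewrite disjoints_subset setCK subsetUl.
- by rewrite disjoint_sym disjoints_subset setCK subsetUr.
- have := cardsC (A :|: C); have := cardsUI A C.
  rewrite (disjoint_setI0 AC) cards0 addn0 Aa Cc card_ord; lia.
Qed.

Lemma sum_mod_deal (a b c d : nat) (A B C : {set 'I_d}) :
    d = (a + b + c)%N -> is_deal a b c A B C ->
  sum_mod A + sum_mod B = sum_mod (~: C).
Proof.
move=> hd [[AB AC BC] [Aa Bb Cc]]; rewrite /sum_mod -bigU //=.
apply: eq_bigl; suff -> : ~: C = A :|: B by move=> x; rewrite !inE.
apply/esym/eqP; rewrite eqEcard subUset.
rewrite !disjoints_subset in AC BC; rewrite AC BC /=.
rewrite cardsU (disjoint_setI0 AB) cards0 subn0 Aa Bb.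
by rewrite -(leq_add2l c) -{1}Cc cardsC card_ord; lia.
Qed.

Lemma sum_mod_dual (a b c d : nat) (A B A' B' C : {set 'I_d}) :
    d = (a + b + c)%N -> is_deal a b c A B C -> is_deal a b c A' B' C ->
  sum_mod A' = sum_mod A <-> sum_mod B' = sum_mod B.
Proof.
move=> hd /(sum_mod_deal hd) eqS /(sum_mod_deal hd); rewrite -eqS => {}eqS.
by split=> eq1; rewrite eq1 in eqS; [apply: addrI eqS|apply: addIr eqS].
Qed.

Lemma eq_sum_mod (d : nat) (A B : {set 'I_d}) : (1 < d)%N ->
  sum_mod A = sum_mod B <->
  (\sum_(x in A) x = \sum_(x in B) x %[mod d])%N.
Proof.
move=> d_gt1; rewrite /sum_mod -!natr_sum; split.
  by move/(congr1 (@nat_of_ord _)); rewrite !val_Zp_nat.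
by move=> eqm; apply: val_inj; rewrite /= !val_Zp_nat.
Qed.

(** * Avoiding a card in the first hand *)

(** One half of security; the other half is the same property with [a] and [b] exchanged. *)
Definition first_hand_avoidable (a b c d : nat) : Prop :=
  forall A B C : {set 'I_d}, is_deal a b c A B C ->
  forall z : 'I_d, z \notin C ->
  exists A' B' : {set 'I_d},
    [/\ is_deal a b c A' B' C, sum_mod A' = sum_mod A & z \notin A'].

Lemma avoidable_of_large (a b c d : nat) :
    (0 < a)%N -> (0 < b)%N -> d = (a + b + c)%N -> prime d ->
  (d <= a * b.-1 + 1)%N -> first_hand_avoidable a b c d.
Proof.
move=> a_gt0 b_gt0 hd d_pr le_d A B C [_ [_ _ Cc]] z zC.
pose X := ~: (z |: C).
have cardX : #|X| = (a + b).-1.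
  by have := cardsC (z |: C); rewrite cardsU1 zC Cc card_ord -/X; lia.
pose phi (x : 'I_d) : 'F_d := (x : nat)%:R.
have phi_inj : {in X &, injective phi}.
  move=> x y _ _ /(congr1 (@nat_of_ord _)); rewrite !val_Fp_nat //.
  by rewrite !modn_small // => /val_inj.
have [|||A' [A'X A'a A'sum]] := @restricted_sums_full d a _ phi X d_pr phi_inj
    _ _ _ (\sum_(x in A) phi x).
- by rewrite cardX; lia.
- by rewrite cardX; lia.
- rewrite cardX; have -> : ((a + b).-1 - a = b.-1)%N by lia.
  lia.
have A'C : [disjoint A' & C].
  rewrite disjoints_subset; apply: subset_trans A'X _.
  by rewrite setCS subsetUr.
exists A', (~: (A' :|: C)); split.
- exact: is_deal_setC.
- apply/eq_sum_mod; first exact: prime_gt1.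
  move: A'sum; rewrite -!natr_sum => /(congr1 (@nat_of_ord _)).
  by rewrite !val_Fp_nat.
- by apply/negP => /(subsetP A'X); rewrite !inE eqxx.
Qed.

(* When [d > a (b - 1) + 1], let Cath hold the top [c] cards, and Alice the
   cards [b - 1, ..., a + b - 3] and [z = a + b - 1]: her sum exceeds by one the
   largest sum of [a] cards below [z], and these sums span too short an interval
   to reach it modulo [d]. *)
Lemma large_of_avoidable (a b c d : nat) :
    (0 < a)%N -> (0 < b)%N -> d = (a + b + c)%N -> prime d ->
  first_hand_avoidable a b c d -> (d <= a * b.-1 + 1)%N.
Proof.
move=> a_gt0 b_gt0 hd d_pr avoid; rewrite leqNgt; apply/negP => lt_d.
have d_gt1 := prime_gt1 d_pr.
pose C : {set 'I_d} := [set x : 'I_d | (a + b <= x)%N].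
(* The last summand moves Alice's top card up by one, onto [z]. *)
have fP (j : 'I_a) : (j + b.-1 + (j == a.-1 :> nat) < d)%N.
  by have := ltn_ord j; lia.
pose f j : 'I_d := Ordinal (fP j).
have f_inj : injective f.
  move=> i j /(congr1 (@nat_of_ord _)) /= eq_f; apply: val_inj => /=.
  by have := ltn_ord i; have := ltn_ord j; lia.
pose A : {set 'I_d} := f @: setT.
have Aa : #|A| = a by rewrite card_imset // cardsT card_ord.
have Cc : #|C| = c.
  have -> : C = ~: [set x : 'I_d | (x < a + b)%N].
    by apply/setP => x; rewrite !inE -leqNgt.
  have abd : (a + b <= d)%N by lia.
  have -> : [set x : 'I_d | (x < a + b)%N] = widen_ord abd @: setT.
    apply/setP => x; rewrite inE; apply/idP/imsetP => [lt_x|[y _ ->]];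
      last first.
      by rewrite /= ltn_ord.
    by exists (Ordinal lt_x) => //; apply: val_inj.
  rewrite cardsCs setCK card_imset; first by rewrite cardsT !card_ord; lia.
  by move=> i j /(congr1 (@nat_of_ord _)) eq_ij; apply: val_inj.
have AC : [disjoint A & C].
  rewrite disjoints_subset; apply/subsetP => _ /imsetP[j _ ->].
  by rewrite !inE /= -ltnNge; have := ltn_ord j; lia.
have zP : ((a + b).-1 < d)%N by lia.
have [|A' [B' [[[_ A'C _] [A'a _ _]] /eq_sum_mod eq_sum zA']]] :=
    avoid _ _ _ (is_deal_setC hd AC Aa Cc) (Ordinal zP).
  by rewrite inE /= -ltnNge; lia.
have {eq_sum} := eq_sum d_gt1.
have A'_lt x : x \in A' -> (x <= (a + b).-2)%N.
  move=> A'x; have := disjointFr A'C A'x; rewrite inE.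
  have : x != Ordinal zP by apply: contraNneq zA' => <-.
  by rewrite -val_eqE /=; lia.
have lo := @sum_inj_lower _ (@nat_of_ord d) A' (in2W (@ord_inj d)).
(* Reflecting the cards below [z] turns the lower bound into an upper one. *)
have hi : (\sum_(j < #|A'|) j <= \sum_(x in A') ((a + b).-2 - x))%N.
  by apply: sum_inj_lower => x y /A'_lt ? /A'_lt ? ?; apply: val_inj => /=; lia.
have tot : (\sum_(x in A') ((a + b).-2 - x) + \sum_(x in A') x =
    a * (a + b).-2)%N.
  rewrite -big_split /=.
  transitivity (\sum_(x in A') (a + b).-2)%N; last by rewrite sum_nat_const A'a.
  by apply: eq_bigr => x /A'_lt /subnK.
have sumA : (\sum_(x in A) x = \sum_(j < a) j + a * b.-1 + 1)%N.
  rewrite big_imset /=; last exact: in2W.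
  under eq_bigl => j do rewrite inE.
  rewrite !big_split /= sum_nat_const card_ord; congr addn.
  have aP : (a.-1 < a)%N by lia.
  rewrite (bigD1 (Ordinal aP)) //= eqxx big1 // => j.
  by rewrite -val_eqE /= => /negPf ->.
rewrite A'a in lo hi; have dbl := sum_ord_double a.
have split_ab : ((a + b).-2 = a.-1 + b.-1)%N by lia.
have {hi tot} hi : (\sum_(x in A') x <= \sum_(j < a) j + a * b.-1)%N.
  by rewrite split_ab mulnDr -dbl in tot hi; move: tot hi; lia.
(* The two sums differ by at least 1 and at most [a * b.-1 + 1 < d], so [d] cannot divide the
   difference. *)
rewrite sumA => /eqP; rewrite eq_sym eqn_mod_dvd; last by move: hi; lia.
move=> /(dvdn_leq _) le_d; have {le_d} := le_d _; rewrite subn_gt0.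
by move: (\sum_(x in A') x)%N lo hi => S' lo hi; lia.
Qed.

Lemma avoidable_iff (a b c d : nat) :
    (0 < a)%N -> (0 < b)%N -> d = (a + b + c)%N -> prime d ->
  first_hand_avoidable a b c d <-> (d <= a * b.-1 + 1)%N.
Proof.
by move=> *; split; [apply: large_of_avoidable|apply: avoidable_of_large].
Qed.

(** * Security criterion *)

Lemma secure_alice_iff (a b c d : nat) : d = (a + b + c)%N ->
  secure a b c (@alice_announces_sum d) <->
  first_hand_avoidable a b c d /\ first_hand_avoidable b a c d.
Proof.
move=> hd; rewrite /alice_announces_sum; split=> [sec|[avA avB] A B C D z zC].
  split=> [A B C /sec D z /D[]//|B A C D z zC].
  have D' := is_deal_swap D.
  have [_ [A' [B' [D'' eqA zB']]]] := sec _ _ _ D' z zC.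
  exists B', A'; split=> //; first exact: is_deal_swap.
  by apply/(sum_mod_dual hd D' D'').
split; first exact: avA D z zC.
have [B' [A' [D' eqB zB']]] := avB _ _ _ (is_deal_swap D) z zC.
have D'' := is_deal_swap D'; exists A', B'; split=> //.
by apply/(sum_mod_dual hd D D'').
Qed.

Lemma secure_alice_bob (a b c d : nat) : d = (a + b + c)%N ->
  secure a b c (@alice_announces_sum d) <->
  secure a b c (@bob_announces_sum d).
Proof.
by move=> hd; split=> sec A B C D z zC;
  have [[A1 [B1 [D1 eq1 z1]]] [A2 [B2 [D2 eq2 z2]]]] := sec A B C D z zC;
  (split; [exists A1, B1; split=> //; apply/(sum_mod_dual hd D D1)
          |exists A2, B2; split=> //; apply/(sum_mod_dual hd D D2)]).
Qed.

Theorem mainTheorem5 (a b c d : nat)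
    (ha : (1 <= a)%N) (hb : (1 <= b)%N) (hc : (1 <= c)%N)
    (hd : d = (a + b + c)%N) (hp : prime d) :
  (secure a b c (@alice_announces_sum d) <->
   secure a b c (@bob_announces_sum d)) /\
  (secure a b c (@alice_announces_sum d) <->
     a%:Z * b%:Z - 2 * a%:Z - b%:Z - c%:Z + 1 >= 0 /\
     a%:Z * b%:Z - 2 * b%:Z - a%:Z - c%:Z + 1 >= 0).
Proof.
split; first exact: secure_alice_bob.
rewrite secure_alice_iff // avoidable_iff // avoidable_iff //; last first.
  by rewrite hd; lia.
split=> -[ineq1 ineq2]; split; nia.
Qed.
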